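(* Let $0<p\le q\le1$ and $\beta\ge0$. On every finite graph $G=(V,E)$ and for every $a\in\mathbb Z^V$, $$F_{G,\mathrm{bond}}(p,\beta;a)\ge F_{G,\mathrm{bond}}\bigl(q,B_1(p/q,\beta);a\bigr).$$ If moreover $G$ is bipartite with maximum degree at most $\Delta\ge1$, then for every $a\in\mathbb Z^V$, $$F_{G,\mathrm{site}}(p,\beta;a)\ge F_{G,\mathrm{site}}\bigl(q,B_\Delta((p/q)^2,\beta);a\bigr).$$
   Context: For $\kappa>0$, $t\ge0$, $r\in[0,1]$, set $H_\kappa(t)=1-e^{-2\kappa t}$ and $$B_\kappa(r,t)=H_\kappa^{-1}\bigl(rH_\kappa(t)\bigr)=-\frac1{2\kappa}\log\bigl(1-r(1-e^{-2\kappa t})\bigr).$$ Let $\mathbb T=\mathbb R/(2\pi\mathbb Z)$. For a finite graph $G=(V,E)$ and couplings $J_e\ge0$, the XY Gibbs measure is $$d\mu_{G,J}(\theta)=\frac1{Z_{G,J}}\exp\Bigl(\sum_{e=\{u,v\}\in E}J_e\cos(\theta_u-\theta_v)\Bigr)\prod_{v\in V}\frac{d\theta_v}{2\pi},\qquad\theta\in\mathbb T^V,$$ with expectation $\langle\cdot\rangle_{G,J}$. For $a\in\mathbb Z^V$, $C_a(J)=\langle\cos(a\cdot\theta)\rangle_{G,J}$ with $a\cdot\theta=\sum_v a_v\theta_v$. In the bond model at density $p$ and inverse temperature $\beta$, $J_e=\beta\omega_e$ with $(\omega_e)_{e\in E}$ i.i.d. Bernoulli($p$). In the site model, $J_{\{u,v\}}=\beta\eta_u\eta_v$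 with $(\eta_v)_{v\in V}$ i.i.d. Bernoulli($p$); all vertices retain their angle variables, including vacant ones. $F_{G,\mathrm{bond}}(p,\beta;a)$ and $F_{G,\mathrm{site}}(p,\beta;a)$ denote the expectation of $C_a(J)$ over the disorder in the bond and site model respectively. *)

(* Defs.v *)
From HB Require Import structures.
From mathcomp Require Import all_boot all_order all_algebra.
From mathcomp Require Import all_classical all_reals all_analysis.

Set Implicit Arguments.
Unset Strict Implicit.
Unset Printing Implicit Defensive.

Import Order.TTheory GRing.Theory Num.Theory.
Import numFieldNormedType.Exports.

Local Open Scope ring_scope.

Section ProductProbability.
Context d (T : measurableType d) (R : realType) (P : probability T R).

Definition consT n (x : T * n.-tuple T) : n.+1.-tuple T :=
  [the n.+1.-tuple T of x.1 :: x.2].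

Lemma measurable_consT n :
  measurable_fun [set: T * n.-tuple T] (@consT n).
Proof. exact: measurable_cons. Qed.

HB.instance Definition _ n :=
  isMeasurableFun.Build _ _ _ _ (@consT n) (@measurable_consT n).

(* The n-fold product measure P \x ... \x P, carried by the product
   sigma-algebra of n.-tuple T. *)
Fixpoint iid_prob n : probability (n.-tuple T) R :=
  match n with
  | 0 => [the probability _ _ of dirac [tuple]]
  | m.+1 => [the probability _ _ of
      distribution [the probability _ _ of (P \x iid_prob m)%E] (@consT m)]
  end.

Lemma measurable_box n (A : 'I_n -> set T) : (forall i, measurable (A i)) ->
  measurable ([set t | forall i, A i (tnth t i)]%classic : set (n.-tuple T)).
Proof.
move=> mA.
have -> : ([set t | forall i, A i (tnth t i)]%classic : set (n.-tuple T)) =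
    (\bigcap_(i in [set: 'I_n]) (fun t : n.-tuple T => tnth t i) @^-1` A i)%classic.
  by apply/seteqP; split=> [t tA i _|t tA i]; [exact: tA | exact: tA].
apply: fin_bigcap_measurable; first exact: finite_finset.
by move=> i _; rewrite -[X in measurable X]setTI; exact: measurable_tnth.
Qed.

Lemma iid_prob_box n (A : 'I_n -> set T) : (forall i, measurable (A i)) ->
  iid_prob n [set t | forall i, A i (tnth t i)]%classic
  = (\prod_(i < n) P (A i))%E.
Proof.
elim: n A => [|n IH] A mA.
  by rewrite big_ord0 /= diracE mem_set//= => -[].
rewrite big_ord_recl -IH//= -product_measure1E//; last first.
  by apply: (measurable_box (A := fun i => A (lift ord0 i))) => i; exact: mA.
rewrite /distribution /pushforward; congr (product_measure1 _ _ _).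
apply/seteqP; split=> -[x t] /=.
  move=> tA; split; first exact: (tA ord0).
  by move=> i; have := tA (lift ord0 i); rewrite /consT/= tnthS.
move=> [xA tA] i; case: (unliftP ord0 i) => [j|] -> //.
by rewrite /consT/= tnthS.
Qed.

End ProductProbability.

Section TimeChange.
Context (R : realType).

Definition H_ (kappa t : R) : R := 1 - expR (- (2 * kappa * t)).

Definition B_ (kappa r t : R) : R :=
  - (2 * kappa)^-1 * ln (1 - r * (1 - expR (- (2 * kappa * t)))).

Lemma H_B_ (kappa r t : R) :
  0 < kappa -> 0 <= t -> 0 <= r <= 1 -> H_ kappa (B_ kappa r t) = r * H_ kappa t.
Proof.
move=> k0 t0 /andP[r0 r1]; rewrite /H_ /B_; set h := 1 - expR (- (2 * kappa * t)).
have h0 : 0 <= h.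
  by rewrite subr_ge0 -[leRHS]expR0 ler_expR oppr_le0 mulr_ge0// mulr_ge0// ltW.
have h1 : h < 1 by rewrite ltrBlDr ltrDl expR_gt0.
have rh : r * h < 1 by rewrite (le_lt_trans _ h1)// ler_piMl.
rewrite mulrA mulrN mulfV ?mulN1r ?opprK ?gt_eqF ?mulr_gt0//.
by rewrite lnK ?posrE ?subr_gt0// subKr.
Qed.

End TimeChange.

(* A graph on the vertex set V is given by its edge set E : {set {set V}}. *)
Section Graph.
Context (V : finType) (E : {set {set V}}).

Definition simple_graph : Prop := forall e, e \in E -> #|e| = 2.

Definition bipartite : Prop :=
  exists A : {set V}, forall u v, [set u; v] \in E -> (u \in A) != (v \in A).

Definition degree (v : V) : nat := #|[set e in E | v \in e]|.

Definition max_degree : nat := \max_(v : V) degree v.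

End Graph.

Section XY.
Context (R : realType) (V : finType).

Lemma two_pi_gt0 : 0 < 2 * pi :> R.
Proof. by rewrite mulr_gt0 ?pi_gt0. Qed.

(* An angle of the circle R / (2 pi Z) is represented by a real number in
   [0, 2 pi], and its normalized Haar measure by the uniform law there: all
   the integrands below are 2 pi-periodic in each angle. *)
Definition angle_prob : probability (measurableTypeR R) R :=
  [the probability _ _ of uniform_prob two_pi_gt0].

Definition config := #|V|.-tuple (measurableTypeR R).

Definition angle (theta : config) (v : V) : R := tnth theta (enum_rank v).

Definition config_prob : probability config R := iid_prob angle_prob #|V|.

(* cos (theta_u - theta_v) for e = {u, v}; cos being even, the order in which
   the two endpoints are enumerated is immaterial. *)
Definition edge_cos (theta : config) (e : {set V}) : R :=
  if enum e is [:: u; v] then cos (angle theta u - angle theta v) else 0.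

Lemma edge_cos2 (theta : config) (u v : V) : u != v ->
  edge_cos theta [set u; v] = cos (angle theta u - angle theta v).
Proof.
move=> uv; rewrite /edge_cos.
have := cards2 u v; rewrite uv cardE.
have := enum_uniq [set u; v]; have := mem_enum [set u; v].
case: (enum _) => [//|x [//|y [|//]]] me /=; rewrite inE andbT => xy _.
have := me x; have := me y; rewrite !inE !eqxx orbT /=.
move=> /esym/orP[]/eqP yE /esym/orP[]/eqP xE; subst x y => //.
- by rewrite eqxx in xy.
- by rewrite -cosN opprB.
- by rewrite eqxx in xy.
Qed.

Section Gibbs.
Context (E : {set {set V}}) (J : {set V} -> R).

Definition boltzmann (theta : config) : R :=
  expR (\sum_(e in E) J e * edge_cos theta e).

Definition partition_function : R :=
  (\int[config_prob]_theta boltzmann theta)%R.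

Definition gibbs_density (theta : config) : R :=
  boltzmann theta / partition_function.

Definition gibbs_expectation (f : config -> R) : R :=
  (\int[config_prob]_theta (f theta * gibbs_density theta))%R.

Definition correlation (a : V -> int) : R :=
  gibbs_expectation (fun theta => cos (\sum_(v : V) (a v)%:~R * angle theta v)).

End Gibbs.

(* Expectation of X over i.i.d. Bernoulli(p) variables indexed by S, the
   argument w of X being the set of indices whose variable equals 1. *)
Definition bernoulli_expectation (I : finType) (S : {set I}) (p : R)
    (X : {set I} -> R) : R :=
  \sum_(w in powerset S) (\prod_(i in S) bernoulli_pmf p (i \in w)) * X w.

Definition bond_coupling (beta : R) (w : {set {set V}}) (e : {set V}) : R :=
  beta * (e \in w)%:R.

(* eta is the set of occupied vertices; beta * eta_u * eta_v for e = {u, v}. *)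
Definition site_coupling (beta : R) (eta : {set V}) (e : {set V}) : R :=
  beta * \prod_(v in e) (v \in eta)%:R.

Definition F_bond (E : {set {set V}}) (p beta : R) (a : V -> int) : R :=
  bernoulli_expectation E p (fun w => correlation E (bond_coupling beta w) a).

Definition F_site (E : {set {set V}}) (p beta : R) (a : V -> int) : R :=
  bernoulli_expectation [set: V] p
    (fun eta => correlation E (site_coupling beta eta) a).

End XY.

(* Main.v *)
Require Import Defs.
From mathcomp Require Import all_boot all_order all_algebra.
From mathcomp Require Import all_classical all_reals all_analysis.
From mathcomp Require Import measurable_realfun fintype finset zify ring.

(** The thinned systems are compared one disorder variable at a time. With all
    other variables frozen, turning a variable on adds [t] to the couplings of a
    set of at most [k] edges (one edge in the bond model, the edges from a vertex
    to its occupied neighbours in the site model), and the correlation becomes a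
    function [C] of [t]. Lowering the density of the variable from [q] to [q * r]
    while keeping the time [t] is better than keeping the density [q] and lowering
    the time to [B_ k r t] as soon as
      [C (B_ k r t) <= (1 - r) * C 0 + r * C t].
    Since [H_ k (B_ k r t) = r * H_ k t], this is the convexity of [C] as a function
    of [H_ k t] ([convex_in_H_], [correlation_ray_le]).

    For the convexity, let [S] be the energy of the added edges and [Z] the
    partition function. Then [C' = N / Z ^+ 2], where [N] is [Z ^+ 2] times the Gibbs
    covariance of [cos (a . theta)] and [S]. As [S <= k], the function
    [expR (- (k * t)) * Z t] is nonincreasing ([partition_function_le]). So
    [expR (2 * k * t) * C' t], which is [2 * k] times the derivative of [C] with
    respect to [H_ k], is nondecreasing once [N] is nonnegative and nondecreasing
    ([covariance_ge0], [covariance_le]).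

    Both properties of [N] are instances of Ginibre's inequality. On two independent
    copies of the system, [2 * N] is a sum, over the added edges, of the means of
    products of two differences [cos (m . theta) - cos (m . theta')] with the
    exponential of a nonnegative combination of sums
    [cos (m . theta) + cos (m . theta')]. Expanding the
    exponential, it suffices that a product of such sums and differences has
    nonnegative mean. This holds because that mean is, up to a power of [2], the
    square of a Fourier coefficient ([mean_cos_duplicated_prod]); only the
    orthogonality of the characters of the torus enters.

    The bond model follows edge by edge ([F_bond_thinning]). In the site model the
    time may change at a vertex only if all edges at that vertex carry the same time.
    Bipartiteness guarantees this: one class of vertices is treated first, the
    other one second, and each edge undergoes two changes of time, which compose to
    [B_ Delta (r ^+ 2)] ([B_B], [F_site_thinning]). *)

Set Implicit Arguments.
Unset Strict Implicit.
Unset Printing Implicit Defensive.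

Import Order.TTheory GRing.Theory Num.Theory.
Import numFieldNormedType.Exports.

Local Open Scope ring_scope.

(** * Bounded measurable functions on a probability space *)

Section BoundedMeasurable.
Context d (T : measurableType d) (R : realType) (P : probability T R).
Implicit Types f g F L : T -> R.

Definition bmeas f :=
  measurable_fun [set: T] f /\ exists M, forall x, `|f x| <= M.

Lemma bmeas_cst (c : R) : bmeas (fun=> c).
Proof. by split; [exact: measurable_cst | exists `|c|]. Qed.

Lemma bmeasD f g : bmeas f -> bmeas g -> bmeas (fun x => f x + g x).
Proof.
move=> [mf [M fM]] [mg [N gN]]; split; first exact: measurable_funD.
by exists (M + N) => x; rewrite (le_trans (ler_normD _ _))// lerD.
Qed.

Lemma bmeasM f g : bmeas f -> bmeas g -> bmeas (fun x => f x * g x).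
Proof.
move=> [mf [M fM]] [mg [N gN]]; split; first exact: measurable_funM.
by exists (M * N) => x; rewrite normrM ler_pM.
Qed.

Lemma bmeasZ c f : bmeas f -> bmeas (fun x => c * f x).
Proof. by apply: bmeasM; exact: bmeas_cst. Qed.

Lemma bmeasB f g : bmeas f -> bmeas g -> bmeas (fun x => f x - g x).
Proof.
move=> bf bg; have := bmeasD bf (bmeasZ (-1) bg).
by under [X in bmeas X -> _]eq_fun do rewrite mulN1r.
Qed.

Lemma bmeas_sum (I : Type) (s : seq I) (p : pred I) (f : I -> T -> R) :
  (forall i, bmeas (f i)) -> bmeas (fun x => \sum_(i <- s | p i) f i x).
Proof.
move=> bf; elim: s => [|i s IH].
  by under eq_fun do rewrite big_nil; exact: bmeas_cst.
under eq_fun do rewrite big_cons.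
by case: (p i) => //; exact: bmeasD.
Qed.

Lemma bmeas_prod (I : Type) (s : seq I) (f : I -> T -> R) :
  (forall i, bmeas (f i)) -> bmeas (fun x => \prod_(i <- s) f i x).
Proof.
move=> bf; elim: s => [|i s IH].
  by under eq_fun do rewrite big_nil; exact: bmeas_cst.
by under eq_fun do rewrite big_cons; exact: bmeasM.
Qed.

Lemma bmeasX f n : bmeas f -> bmeas (fun x => f x ^+ n).
Proof.
move=> bf; elim: n => [|n IH].
  by under eq_fun do rewrite expr0; exact: bmeas_cst.
by under eq_fun do rewrite exprS; exact: bmeasM.
Qed.

Lemma bmeas_expR f : bmeas f -> bmeas (fun x => expR (f x)).
Proof.
move=> [mf [M fM]]; split; first exact: measurableT_comp.
exists (expR M) => x; rewrite ger0_norm ?expR_ge0// ler_expR.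
exact: le_trans (ler_norm _) (fM x).
Qed.

Lemma bmeas_cos f : measurable_fun [set: T] f -> bmeas (fun x => cos (f x)).
Proof.
move=> mf; split; last by exists 1 => x; rewrite ler_norml cos_geN1 cos_le1.
by apply: measurableT_comp => //; apply: continuous_measurable_fun;
  exact: continuous_cos.
Qed.

Lemma bmeas_sin f : measurable_fun [set: T] f -> bmeas (fun x => sin (f x)).
Proof.
move=> mf; split; last by exists 1 => x; rewrite ler_norml sin_geN1 sin_le1.
by apply: measurableT_comp => //; apply: continuous_measurable_fun;
  exact: continuous_sin.
Qed.

Lemma bmeas_integrable f : bmeas f -> P.-integrable [set: T] (EFin \o f).
Proof.
move=> [mf [M fM]]; apply: measurable_bounded_integrable => //.
  by apply: (le_lt_trans (probability_le1 _ _)) => //; exact: ltry.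
exists M; split; first exact: num_real.
by move=> N MN x _; exact: le_trans (fM x) (ltW MN).
Qed.

Definition mean f : R := (\int[P]_x f x)%R.

Lemma eq_mean f g : f =1 g -> mean f = mean g.
Proof. by move=> /funext ->. Qed.

Lemma meanZ c f : bmeas f -> mean (fun x => c * f x) = c * mean f.
Proof. by move=> bf; rewrite /mean RintegralZl//; exact: bmeas_integrable. Qed.

Lemma meanD f g : bmeas f -> bmeas g ->
  mean (fun x => f x + g x) = mean f + mean g.
Proof. by move=> bf bg; rewrite /mean RintegralD//; exact: bmeas_integrable. Qed.

Lemma meanB f g : bmeas f -> bmeas g ->
  mean (fun x => f x - g x) = mean f - mean g.
Proof. by move=> bf bg; rewrite /mean RintegralB//; exact: bmeas_integrable. Qed.

Lemma mean_cst c : mean (fun=> c) = c.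
Proof. by rewrite /mean Rintegral_cst// [X in fine X]probability_setT mulr1. Qed.

Lemma mean_sum (I : Type) (s : seq I) (f : I -> T -> R) :
  (forall i, bmeas (f i)) ->
  mean (fun x => \sum_(i <- s) f i x) = \sum_(i <- s) mean (f i).
Proof.
move=> bf; elim: s => [|i s IH].
  by under eq_mean do rewrite big_nil; rewrite mean_cst big_nil.
under eq_mean do rewrite big_cons.
by rewrite meanD// ?IH ?big_cons//; exact: bmeas_sum.
Qed.

Lemma ler_mean f g : bmeas f -> bmeas g -> (forall x, f x <= g x) ->
  mean f <= mean g.
Proof.
by move=> bf bg fg; apply: le_Rintegral => //; exact: bmeas_integrable.
Qed.

Lemma mean_expR_gt0 f : bmeas f -> 0 < mean (fun x => expR (f x)).
Proof.
move=> bf; have [_ [M fM]] := bf.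
apply: (@lt_le_trans _ _ (expR (- M))); first exact: expR_gt0.
rewrite -(mean_cst (expR (- M))); apply: ler_mean.
- exact: bmeas_cst.
- exact: bmeas_expR.
- move=> x; rewrite ler_expR lerNl.
  by rewrite (le_trans _ (fM x))// -normrN ler_norm.
Qed.

(** Dominated convergence: the partial sums are bounded by [expR `|L|]. *)
Lemma cvg_mean_series_exp F L : bmeas F -> bmeas L ->
  (mean (fun x => F x * series (exp_coeff (L x)) n) @[n --> \oo]
    --> mean (fun x => F x * expR (L x)))%classic.
Proof.
move=> bF bL.
have bs n : bmeas (fun x => F x * series (exp_coeff (L x)) n).
  apply: bmeasM => //; apply: bmeas_sum => i.
  under eq_fun do rewrite /exp_coeff/= mulrC.
  by apply: bmeasZ; exact: bmeasX.
have be : bmeas (fun x => F x * expR (L x)).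
  by apply: bmeasM => //; exact: bmeas_expR.
have [_ [M FM]] := bF; have [_ [N LN]] := bL.
apply: fine_cvg.
rewrite fineK; last exact/integrable_fin_num/bmeas_integrable.
apply: (@dominated_cvg _ _ _ P _ _ (fun n x => (F x * series (exp_coeff (L x)) n)%:E)
  _ (fun=> (M * expR N)%:E)) => //.
- by move=> n; apply/measurable_EFinP; case: (bs n).
- move=> x _; apply: cvg_EFin; first exact: nearW.
  by apply: cvgMr; exact: is_cvg_series_exp_coeff.
- by apply: (bmeas_integrable (f := fun=> _)); exact: bmeas_cst.
- move=> n x _; rewrite lee_fin normrM ler_pM//.
  have h : series (exp_coeff `|L x|) n <= expR `|L x|.
    apply: nondecreasing_cvgn_le; last exact: is_cvg_series_exp_coeff.
    by apply: nondecreasing_series => i _ _; exact: exp_coeff_ge0.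
  apply: le_trans (le_trans h _); last by rewrite ler_expR.
  rewrite (le_trans (ler_norm_sum _ _ _))// ler_sum// => i _.
  by rewrite /exp_coeff/= normrM normrX normfV [`|_%:R|]ger0_norm.
Qed.

(** Differentiation under the integral sign: for [s] within distance [1] of [t] the
    derivative of the integrand is bounded by a constant, [F] and [S] being
    bounded. *)
Lemma is_derive_mean_expR F S (t : R) : bmeas F -> bmeas S ->
  is_derive t 1 (fun t => mean (fun x => F x * expR (t * S x)))
    (mean (fun x => F x * S x * expR (t * S x))).
Proof.
move=> bF bS.
have bf s : bmeas (fun x => F x * expR (s * S x)).
  by apply: bmeasM => //; apply: bmeas_expR; exact: bmeasZ.
have df (s : R) x : is_derive s 1 (fun t => F x * expR (t * S x))
                (F x * S x * expR (s * S x)).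
  apply: is_derive_eq; rewrite /GRing.scale/= !(mulr1, mulr0, add0r, addr0).
  ring.
have [_ [M FM]] := bF; have [_ [N SN]] := bS.
pose f (s : R) x := F x * expR (s * S x).
have dfE s x : partial1of2 f s x = F x * S x * expR (s * S x).
  by rewrite partial1of2E; exact: derive_val.
have tI : (`]t - 1, t + 1[%classic : set R) t.
  by rewrite /= in_itv/= ltrBlDr !ltrDl ltr01.
have int_f s : (`]t - 1, t + 1[%classic : set R) s ->
    P.-integrable [set: T] (EFin \o f s).
  by move=> _; exact: bmeas_integrable (bf s).
have der_f s x : (`]t - 1, t + 1[%classic : set R) s -> [set: T]%classic x ->
    derivable (f ^~ x) s 1.
  by move=> _ _; exact: (@ex_derive _ _ _ _ _ _ _ (df s x)).
pose G (x : T) : R := M * N * expR ((`|t| + 1) * N).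
have M0 (x : T) : 0 <= M := le_trans (normr_ge0 _) (FM x).
have N0 (x : T) : 0 <= N := le_trans (normr_ge0 _) (SN x).
have G0 x : 0 <= G x by rewrite mulr_ge0 ?expR_ge0 ?mulr_ge0 ?(M0 x) ?(N0 x).
have int_G : P.-integrable [set: T] (EFin \o G).
  by apply: bmeas_integrable; exact: bmeas_cst.
have G_ub s x : (`]t - 1, t + 1[%classic : set R) s -> [set: T]%classic x ->
    `|partial1of2 f s x| <= G x.
  rewrite /= in_itv/= => /andP[st ts] _; rewrite dfE !normrM !ler_pM//.
  rewrite ger0_norm ?expR_ge0// ler_expR.
  rewrite (le_trans (ler_norm _))// normrM ler_pM//.
  rewrite -(subrK t s) addrC (le_trans (ler_normD _ _))// lerD2l.
  by rewrite ler_norml lerBrDr lerBlDr addrC ltW//= addrC ltW.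
have := @cvg_differentiation_under_integral _ _ _ P f _ measurableT t _ _
  tI int_f der_f G G0 int_G G_ub.
under [X in (_ --> X)%classic -> _]eq_mean do rewrite dfE.
move=> H; split.
  apply/cvg_ex; eexists; under eq_fun do rewrite scaler1; exact: H.
rewrite /derive; under eq_fun do rewrite scaler1.
exact/cvg_lim.
Qed.

End BoundedMeasurable.

(** * Orthogonality of the trigonometric characters *)

Lemma bmeas_tensor d1 d2 (T1 : measurableType d1) (T2 : measurableType d2)
    (R : realType) (u : T1 -> R) (v : T2 -> R) : bmeas u -> bmeas v ->
  bmeas (fun z : T1 * T2 => u z.1 * v z.2).
Proof.
move=> [mu [M uM]] [mv [N vN]].
apply: (@bmeasM _ _ _ (u \o fst) (v \o snd)).
- by split; [exact: measurableT_comp | exists M => z; exact: uM].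
- by split; [exact: measurableT_comp | exists N => z; exact: vN].
Qed.

Lemma mean_prod d1 d2 (T1 : measurableType d1) (T2 : measurableType d2)
    (R : realType) (P1 : probability T1 R) (P2 : probability T2 R)
    (u : T1 -> R) (v : T2 -> R) : bmeas u -> bmeas v ->
  mean (P1 \x P2)%E (fun z => u z.1 * v z.2) = mean P1 u * mean P2 v.
Proof.
move=> bu bv; have buv := bmeas_tensor bu bv.
rewrite /mean /Rintegral -integral12_prod_meas1; last exact: bmeas_integrable.
have inner x : (\int[P2]_y (u x * v y)%:E = (u x)%:E * (mean P2 v)%:E)%E.
  under eq_integral do rewrite EFinM.
  rewrite integralZl//; last exact: bmeas_integrable.
  by rewrite fineK//; exact/integrable_fin_num/bmeas_integrable.
transitivity (fine (\int[P1]_x ((u x)%:E * (mean P2 v)%:E)))%E.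
  by congr fine; apply: eq_integral => x _; exact: inner.
rewrite integralZr//; last exact: bmeas_integrable.
rewrite fineM//; exact/integrable_fin_num/bmeas_integrable.
Qed.

Lemma sin_2pi_int (R : realType) (k : int) : sin (k%:~R * (2 * pi) : R) = 0.
Proof.
have h n : sin (n%:R * (2 * pi) : R) = 0.
  by rewrite -[_ * _]add0r [2 * pi]mulr_natl mulr_natl
    (periodicn (@sinD2pi R)) sin0.
case: k => n; first exact: h.
by rewrite NegzE mulrNz mulNr sinN h oppr0.
Qed.

Lemma cos_2pi_int (R : realType) (k : int) : cos (k%:~R * (2 * pi) : R) = 1.
Proof.
have h n : cos (n%:R * (2 * pi) : R) = 1.
  by rewrite -[_ * _]add0r [2 * pi]mulr_natl mulr_natl
    (periodicn (@cosD2pi R)) cos0.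
case: k => n; first exact: h.
by rewrite NegzE mulrNz mulNr cosN h.
Qed.

Section TrigonometricMoments.
Context (R : realType).
Local Notation angle_prob := (angle_prob R).

(** The fundamental theorem of calculus is applied to [1 + f] because the
    formula for integrals against the uniform law requires a nonnegative
    integrand. *)
Lemma mean_angle0 (f F : R -> R) : continuous f -> (forall x, `|f x| <= 1) ->
  (forall x : R, is_derive x 1 F (f x)) -> F (2 * pi) = F 0 ->
  mean angle_prob f = 0.
Proof.
move=> cf f1 dF FE.
have bf : bmeas (f : measurableTypeR R -> R).
  by split; [exact: continuous_measurable_fun | exists 1].
have b1f : bmeas (fun x : measurableTypeR R => 1 + f x).
  by apply: bmeasD => //; exact: bmeas_cst.
suff : mean angle_prob (fun x => 1 + f x) = 1.
  rewrite meanD//; last exact: bmeas_cst.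
  by rewrite mean_cst => /eqP; rewrite -subr_eq0 [1 + _]addrC addrK => /eqP.
pose G x : R := x + F x.
have dG (x : R) : is_derive x 1 G (1 + f x) by apply: is_deriveD.
have cG x : {for x, continuous G}.
  apply: differentiable_continuous; apply/derivable1_diffP.
  exact: (@ex_derive _ _ _ _ _ _ _ (dG x)).
rewrite /mean /Rintegral integral_uniform; last 2 first.
- by apply/measurable_EFinP; case: b1f.
- move=> x; rewrite lee_fin -lerBlDl sub0r.
  by have := f1 x; rewrite ler_norml => /andP[].
rewrite (continuous_FTC2 (F := G) (two_pi_gt0 R)).
- rewrite /G FE add0r subr0 -EFinB -EFinM addrK /= mulVf// gt_eqF//.
  exact: two_pi_gt0.
- apply: continuous_subspaceT => x.
  by apply: cvgD; [exact: cvg_cst | exact: cf].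
- split.
  + by move=> x _; exact: (@ex_derive _ _ _ _ _ _ _ (dG x)).
  + by apply: cvg_at_right_filter; exact: cG.
  + by apply: cvg_at_left_filter; exact: cG.
- by move=> x _; rewrite derive1E; exact: derive_val.
Qed.

Lemma mean_angle_cos (k : int) :
  mean angle_prob (fun x => cos (k%:~R * x)) = (k == 0)%:R.
Proof.
have [->|k0] := eqVneq k 0.
  by under eq_mean do rewrite mul0r cos0; rewrite mean_cst.
have kR : (k%:~R : R) != 0 by rewrite intr_eq0.
apply: (@mean_angle0 _ (fun x => k%:~R^-1 * sin (k%:~R * x))).
- move=> x; apply: continuous_comp; last exact: continuous_cos.
  exact: mulrl_continuous.
- by move=> x; rewrite ler_norml cos_geN1 cos_le1.
- move=> x; apply: is_derive_eq.
  by rewrite /GRing.scale/= !(mulr1, mulr0, add0r, addr0) mulrCA mulVf ?mulr1.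
- by rewrite sin_2pi_int mulr0 !mulr0 sin0 mulr0.
Qed.

Lemma mean_angle_sin (k : int) :
  mean angle_prob (fun x => sin (k%:~R * x)) = 0.
Proof.
have [->|k0] := eqVneq k 0.
  by under eq_mean do rewrite mul0r sin0; rewrite mean_cst.
have kR : (k%:~R : R) != 0 by rewrite intr_eq0.
apply: (@mean_angle0 _ (fun x => - (k%:~R^-1 * cos (k%:~R * x)))).
- move=> x; apply: continuous_comp; last exact: continuous_sin.
  exact: mulrl_continuous.
- by move=> x; rewrite ler_norml sin_geN1 sin_le1.
- move=> x; apply: is_derive_eq.
  rewrite /GRing.scale/= !(mulr1, mulr0, add0r, addr0).
  by rewrite mulNr mulrN opprK mulrCA mulVf ?mulr1.
- by rewrite cos_2pi_int mulr0 cos0.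
Qed.

Lemma measurable_linear_tuple n (m : 'I_n -> R) :
  measurable_fun [set: n.-tuple (measurableTypeR R)]
    (fun x => \sum_(i < n) m i * tnth x i).
Proof.
apply: measurable_sum => i.
by apply: measurable_funM; [exact: measurable_cst | exact: measurable_tnth].
Qed.

Lemma mean_iidS n (f : n.+1.-tuple (measurableTypeR R) -> R) : bmeas f ->
  mean (iid_prob angle_prob n.+1) f =
  mean (angle_prob \x iid_prob angle_prob n)%E (fun z => f (consT z)).
Proof.
move=> bf; have [mf [M fM]] := bf; rewrite /mean /Rintegral/=.
rewrite integral_distribution//; first exact/measurable_EFinP.
apply: (@bmeas_integrable _ _ _ _ (f \o @consT _ _ n)); split.
  by apply: measurableT_comp => //; exact: measurable_consT.
by exists M => x; exact: fM.
Qed.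

(** The cosine and the sine are treated together because the addition formulas
    mix them in the induction on the number of angles. *)
Lemma mean_iid_trig n (m : 'I_n -> int) :
  mean (iid_prob angle_prob n)
    (fun x => cos (\sum_(i < n) (m i)%:~R * tnth x i)) = [forall i, m i == 0]%:R
  /\ mean (iid_prob angle_prob n)
    (fun x => sin (\sum_(i < n) (m i)%:~R * tnth x i)) = 0.
Proof.
elim: n m => [|n IH] m.
  split; under eq_mean do rewrite big_ord0 ?cos0 ?sin0; rewrite mean_cst//.
  by have -> : [forall i, m i == 0] by apply/forallP; case.
pose m' (i : 'I_n) := m (lift ord0 i).
have [IHc IHs] := IH m'.
have ml := measurable_linear_tuple (fun i => (m i)%:~R).
have ml' := measurable_linear_tuple (fun i => (m' i)%:~R).
have mx : measurable_fun [set: measurableTypeR R] (fun x : R => (m ord0)%:~R * x).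
  by apply: continuous_measurable_fun; exact: mulrl_continuous.
have sumE (z : measurableTypeR R * n.-tuple (measurableTypeR R)) :
    \sum_(i < n.+1) (m i)%:~R * tnth (consT z) i =
    (m ord0)%:~R * z.1 + \sum_(i < n) (m' i)%:~R * tnth z.2 i.
  rewrite big_ord_recl /consT tnth0; congr (_ + _).
  by apply: eq_bigr => i _; rewrite tnthS.
pose c0 (x : measurableTypeR R) : R := cos ((m ord0)%:~R * x).
pose s0 (x : measurableTypeR R) : R := sin ((m ord0)%:~R * x).
pose c1 (x : n.-tuple (measurableTypeR R)) : R :=
  cos (\sum_(i < n) (m' i)%:~R * tnth x i).
pose s1 (x : n.-tuple (measurableTypeR R)) : R :=
  sin (\sum_(i < n) (m' i)%:~R * tnth x i).
have bc0 : bmeas c0 by exact: bmeas_cos.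
have bs0 : bmeas s0 by exact: bmeas_sin.
have bc1 : bmeas c1 by exact: bmeas_cos.
have bs1 : bmeas s1 by exact: bmeas_sin.
split.
- rewrite mean_iidS; last exact: bmeas_cos.
  under eq_mean do rewrite sumE cosD -/(c0 _) -/(s0 _) -/(c1 _) -/(s1 _).
  rewrite meanB; [|exact: bmeas_tensor|exact: bmeas_tensor].
  rewrite !(mean_prod angle_prob (iid_prob angle_prob n))//.
  rewrite mean_angle_cos mean_angle_sin mul0r subr0 IHc -natrM mulnb.
  congr (nat_of_bool _)%:R; apply/andP/forallP.
    move=> [m0 /forallP m'0] i; case: (unliftP ord0 i) => [j|] ->//.
    exact: m'0.
  by move=> m0; split => //; apply/forallP => i; exact: m0.
- rewrite mean_iidS; last exact: bmeas_sin.
  under eq_mean do rewrite sumE sinD -/(c0 _) -/(s0 _) -/(c1 _) -/(s1 _).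
  rewrite meanD; [|exact: bmeas_tensor|exact: bmeas_tensor].
  rewrite !(mean_prod angle_prob (iid_prob angle_prob n))//.
  by rewrite mean_angle_sin IHs mul0r mulr0 addr0.
Qed.

Context (V : finType).

Definition phase (m : V -> int) (theta : config R V) : R :=
  \sum_(v : V) (m v)%:~R * angle theta v.

Lemma phaseE m theta : phase m theta =
  \sum_(i < #|V|) (m (enum_val i))%:~R * tnth theta i.
Proof.
rewrite /phase (reindex (@enum_val V predT))/=; last first.
  by exists enum_rank => x _; [exact: enum_valK | exact: enum_rankK].
by apply: eq_bigr => i _; rewrite /angle enum_valK.
Qed.

Lemma measurable_phase m : measurable_fun [set: config R V] (phase m).
Proof.
rewrite (funext (phaseE m)).
exact: (measurable_linear_tuple (fun i => (m (enum_val i))%:~R)).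
Qed.

Lemma mean_cos_phase m : mean (config_prob R V) (fun theta => cos (phase m theta)) =
  [forall v, m v == 0]%:R.
Proof.
under eq_mean do rewrite phaseE.
have [-> _] := mean_iid_trig (fun i : 'I_#|V| => m (enum_val i)).
congr (nat_of_bool _)%:R; apply/forallP/forallP => m0 x; last exact: m0.
by rewrite -[x]enum_rankK; exact: m0.
Qed.

Lemma mean_sin_phase m :
  mean (config_prob R V) (fun theta => sin (phase m theta)) = 0.
Proof.
under eq_mean do rewrite phaseE.
by have [_ ->] := mean_iid_trig (fun i : 'I_#|V| => m (enum_val i)).
Qed.

End TrigonometricMoments.

(** * Ginibre's inequality *)

Section Ginibre.
Context (R : realType) (V : finType).
Local Notation config := (config R V).
Local Notation P2 := (config_prob R V \x config_prob R V)%E.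
Implicit Types (M m : V -> int) (z : config * config) (F : config * config -> R).

Lemma phaseD M m (theta : config) :
  phase (fun v => M v + m v) theta = phase M theta + phase m theta.
Proof.
by rewrite /phase -big_split; apply: eq_bigr => v _; rewrite intrD mulrDl.
Qed.

Lemma phaseB M m (theta : config) :
  phase (fun v => M v - m v) theta = phase M theta - phase m theta.
Proof.
rewrite /phase -sumrN -big_split; apply: eq_bigr => v _ /=.
by rewrite intrB mulrBl.
Qed.

(** The pair [(s, m)] encodes the sum ([s = false]) or the difference ([s = true])
    of the two copies of [cos (m . theta)]. *)
Definition duplicated (i : bool * (V -> int)) z : R :=
  cos (phase i.2 z.1) + (-1) ^+ i.1 * cos (phase i.2 z.2).

Definition duplicated_prod (l : seq (bool * (V -> int))) z : R :=
  \prod_(i <- l) duplicated i z.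

Lemma bmeas_fst (f : config -> R) : bmeas f -> bmeas (fun z => f z.1).
Proof.
move=> [mf [M fM]]; split; last by exists M => z; exact: fM.
by apply: (measurableT_comp mf); exact: measurable_fst.
Qed.

Lemma bmeas_snd (f : config -> R) : bmeas f -> bmeas (fun z => f z.2).
Proof.
move=> [mf [M fM]]; split; last by exists M => z; exact: fM.
by apply: (measurableT_comp mf); exact: measurable_snd.
Qed.

Lemma bmeas_cos_phase m : bmeas (fun theta : config => cos (phase m theta)).
Proof. by apply: bmeas_cos; exact: measurable_phase. Qed.

Lemma bmeas_sin_phase m : bmeas (fun theta : config => sin (phase m theta)).
Proof. by apply: bmeas_sin; exact: measurable_phase. Qed.

Lemma bmeas_duplicated i : bmeas (duplicated i).
Proof.
apply: bmeasD; first exact: (bmeas_fst (bmeas_cos_phase i.2)).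
by apply: bmeasZ; exact: (bmeas_snd (bmeas_cos_phase i.2)).
Qed.

Lemma bmeas_duplicated_prod l : bmeas (duplicated_prod l).
Proof. by apply: bmeas_prod => i; exact: bmeas_duplicated. Qed.

Lemma bmeas_cos_pair M m : bmeas (fun z => cos (phase M z.1 + phase m z.2)).
Proof.
apply: bmeas_cos; apply: measurable_funD.
- by apply: (measurableT_comp (measurable_phase M)); exact: measurable_fst.
- by apply: (measurableT_comp (measurable_phase m)); exact: measurable_snd.
Qed.

Lemma mean_cos_pair M m :
  mean P2 (fun z => cos (phase M z.1 + phase m z.2)) =
  [forall v, M v == 0]%:R * [forall v, m v == 0]%:R.
Proof.
under eq_mean do rewrite cosD.
have bc := bmeas_cos_phase; have bs := bmeas_sin_phase.
rewrite (@meanB _ _ _ P2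
  (fun z => cos (phase M z.1) * cos (phase m z.2))
  (fun z => sin (phase M z.1) * sin (phase m z.2))); last 2 first.
- exact: (bmeas_tensor (bc M) (bc m)).
- exact: (bmeas_tensor (bs M) (bs m)).
rewrite (mean_prod (config_prob R V) (config_prob R V) (bc M) (bc m)).
rewrite (mean_prod (config_prob R V) (config_prob R V) (bs M) (bs m)).
by rewrite !mean_cos_phase !mean_sin_phase mul0r subr0.
Qed.

(** The constant Fourier coefficient of
    [z ^ M * \prod_i (z ^ (k_i) + (-1) ^+ s_i * z ^ (- k_i))],
    where [(s_i, k_i)] are the entries of [l]. *)
Fixpoint fourier_coef (l : seq (bool * (V -> int))) M : R :=
  if l is i :: l' then
    fourier_coef l' (fun v => M v + i.2 v) +
    (-1) ^+ i.1 * fourier_coef l' (fun v => M v - i.2 v)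
  else [forall v, M v == 0]%:R.

(** Each factor satisfies
    [2 * (cos x + s * cos y) = (u + s * u^-1) * (v + s * v^-1)] for [s = 1, -1], with
    [u] and [v] of arguments [(x + y) / 2] and [(x - y) / 2]. The product therefore
    decouples in the variables [M + m] and [M - m], and the two resulting factors
    coincide when [M = m = 0]. Keeping [M] and [m] free makes this an induction on
    [l] through the product-to-sum formulas, without halving any angle. *)
Lemma mean_cos_duplicated_prod l M m :
  mean P2 (fun z => cos (phase M z.1 + phase m z.2) * duplicated_prod l z) =
  2^-1 ^+ size l * (fourier_coef l (fun v => M v + m v) *
                    fourier_coef l (fun v => M v - m v)).
Proof.
elim: l M m => [|[s k] l IH] M m.
  under eq_mean do rewrite /duplicated_prod big_nil mulr1.
  rewrite mean_cos_pair /= expr0 mul1r -!natrM !mulnb.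
  congr (nat_of_bool _)%:R; apply/andP/andP => -[/forallP h1 /forallP h2].
    split; apply/forallP => v; rewrite (eqP (h1 v)) (eqP (h2 v)).
      by rewrite addr0.
    by rewrite subr0.
  split; apply/forallP => v; have /eqP := h1 v; have /eqP := h2 v.
    by lia.
  by lia.
pose X M m z : R := cos (phase M z.1 + phase m z.2) * duplicated_prod l z.
have bX M1 m1 : bmeas (X M1 m1).
  by apply: bmeasM; [exact: bmeas_cos_pair | exact: bmeas_duplicated_prod].
transitivity (mean P2 (fun z => 2^-1 *
  ((X (fun v => M v + k v) m z + X (fun v => M v - k v) m z) +
  (-1) ^+ s * (X M (fun v => m v + k v) z + X M (fun v => m v - k v) z)))).
  apply: eq_mean => z; rewrite /X /duplicated_prod big_cons.
  set Q := \prod_(i <- l) _; rewrite /duplicated /= !phaseB !phaseD.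
  set a := phase M z.1; set b := phase m z.2.
  set x := phase k z.1; set y := phase k z.2.
  have -> : a + x + b = a + b + x by ring.
  have -> : a - x + b = a + b - x by ring.
  have -> : a + (b + y) = a + b + y by ring.
  have -> : a + (b - y) = a + b - y by ring.
  by rewrite !(cosD (a + b)) !cosN !sinN; field.
rewrite meanZ; last first.
  by apply: bmeasD; [|apply: bmeasZ]; exact: bmeasD.
rewrite meanD; [|exact: bmeasD|by apply: bmeasZ; exact: bmeasD].
rewrite meanZ; last exact: bmeasD.
rewrite !meanD// !IH /= exprS.
(* The four products produced by the induction hypothesis are those of the
   expansion of the right-hand side, once the shifted indices are reordered. *)
pose c A := fourier_coef l A.
have E A B : A =1 B -> fourier_coef l A = c B by move=> /funext ->.
rewrite (E (fun v => M v + k v + m v) (fun v => M v + m v + k v)) => [|v]; last by ring.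
rewrite (E (fun v => M v + k v - m v) (fun v => M v - m v + k v)) => [|v]; last by ring.
rewrite (E (fun v => M v - k v + m v) (fun v => M v + m v - k v)) => [|v]; last by ring.
rewrite (E (fun v => M v - k v - m v) (fun v => M v - m v - k v)) => [|v]; last by ring.
rewrite (E (fun v => M v + (m v + k v)) (fun v => M v + m v + k v)) => [|v]; last by ring.
rewrite (E (fun v => M v - (m v + k v)) (fun v => M v - m v - k v)) => [|v]; last by ring.
rewrite (E (fun v => M v + (m v - k v)) (fun v => M v + m v - k v)) => [|v]; last by ring.
rewrite (E (fun v => M v - (m v - k v)) (fun v => M v - m v + k v)) => [|v]; last by ring.
by rewrite /c; case: s; rewrite ?expr0 ?expr1; ring.
Qed.

Lemma mean_duplicated_prod_ge0 l : 0 <= mean P2 (duplicated_prod l).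
Proof.
have := mean_cos_duplicated_prod l (fun=> 0) (fun=> 0).
have -> : (fun v : V => (0 : int) - 0) = (fun v => 0 + 0) by [].
have phase0 theta : phase (fun=> 0 : int) theta = 0 :> R.
  by rewrite /phase big1// => v _; rewrite mul0r.
under eq_mean do rewrite !phase0 addr0 cos0 mul1r.
move=> ->; rewrite mulr_ge0 ?exprn_ge0//.
by rewrite -expr2 sqr_ge0.
Qed.

(** Testing against every product of sums and differences makes the class stable
    under multiplication by such a factor, hence by power series in them with
    nonnegative coefficients. *)
Definition ginibre_cone F : Prop :=
  bmeas F /\ forall l, 0 <= mean P2 (fun z => F z * duplicated_prod l z).

Lemma ginibre_mean_ge0 F : ginibre_cone F -> 0 <= mean P2 F.
Proof.
move=> [_ /(_ [::])]; congr (0 <= _); apply: eq_mean => z.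
by rewrite /duplicated_prod big_nil mulr1.
Qed.

Lemma ginibre_prod l : ginibre_cone (duplicated_prod l).
Proof.
split; first exact: bmeas_duplicated_prod.
move=> l'; have := mean_duplicated_prod_ge0 (l ++ l').
congr (0 <= _); apply: eq_mean => z.
by rewrite /duplicated_prod big_cat.
Qed.

Lemma ginibre_mul_duplicated F i :
  ginibre_cone F -> ginibre_cone (fun z => F z * duplicated i z).
Proof.
move=> [bF F0]; split; first by apply: bmeasM => //; exact: bmeas_duplicated.
move=> l; have := F0 (i :: l); congr (0 <= _); apply: eq_mean => z.
by rewrite /duplicated_prod big_cons mulrA.
Qed.

Let bprod F l : bmeas F -> bmeas (fun z => F z * duplicated_prod l z).
Proof. by move=> bF; apply: bmeasM => //; exact: bmeas_duplicated_prod. Qed.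

Lemma ginibreZ F c : 0 <= c -> ginibre_cone F -> ginibre_cone (fun z => c * F z).
Proof.
move=> c0 [bF F0]; split; first exact: bmeasZ.
move=> l; under eq_mean do rewrite -mulrA.
by rewrite meanZ ?mulr_ge0//; exact: bprod.
Qed.

Lemma ginibreD F G :
  ginibre_cone F -> ginibre_cone G -> ginibre_cone (fun z => F z + G z).
Proof.
move=> [bF F0] [bG G0]; split; first exact: bmeasD.
move=> l; under eq_mean do rewrite mulrDl.
by rewrite meanD ?addr_ge0//; exact: bprod.
Qed.

Lemma ginibre_sum (I : Type) (s : seq I) (F : I -> config * config -> R) :
  (forall i, ginibre_cone (F i)) ->
  ginibre_cone (fun z => \sum_(i <- s) F i z).
Proof.
move=> gF; elim: s => [|i s IH].
  rewrite (_ : (fun z => _) = (fun z => 0 * duplicated_prod [::] z)).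
    by apply: ginibreZ => //; exact: ginibre_prod.
  by apply/funext => z; rewrite big_nil mul0r.
rewrite (_ : (fun z => _) = (fun z => F i z + \sum_(j <- s) F j z)).
  exact: ginibreD.
by apply/funext => z; rewrite big_cons.
Qed.

Section Exponential.
Context (I : Type) (s : seq I) (w : I -> R) (k : I -> V -> int).
Hypothesis w0 : forall i, 0 <= w i.

Let L z : R := \sum_(i <- s) w i * duplicated (false, k i) z.

Let bL : bmeas L.
Proof. by apply: bmeas_sum => i; apply: bmeasZ; exact: bmeas_duplicated. Qed.

Let ginibre_mulL F n : ginibre_cone F -> ginibre_cone (fun z => F z * L z ^+ n).
Proof.
move=> gF; elim: n => [|n IH].
  by under [X in ginibre_cone X]eq_fun do rewrite expr0 mulr1.
rewrite (_ : (fun z => _) =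
  (fun z => \sum_(i <- s) w i * ((F z * L z ^+ n) * duplicated (false, k i) z))).
  apply: ginibre_sum => i; apply: ginibreZ => //.
  exact: ginibre_mul_duplicated.
apply/funext => z; rewrite exprSr mulrA {3}/L mulr_sumr.
by apply: eq_bigr => i _; rewrite mulrCA.
Qed.

(** The power series of [expR L - 1] has nonnegative coefficients. This is stronger
    than the statement for [expR L] and yields monotonicity in the couplings. *)
Lemma ginibre_expR_sub1 F : ginibre_cone F ->
  ginibre_cone (fun z => F z * (expR (L z) - 1)).
Proof.
move=> gF; have [bF F0] := gF; split.
  apply: bmeasM => //; apply: bmeasB; last exact: bmeas_cst.
  exact: bmeas_expR.
move=> l; pose G z := F z * duplicated_prod l z.
have bG : bmeas G by exact: bprod.
have bGe : bmeas (fun z => G z * expR (L z)).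
  by apply: bmeasM => //; exact: bmeas_expR.
have -> : mean P2 (fun z => F z * (expR (L z) - 1) * duplicated_prod l z) =
    mean P2 (fun z => G z * expR (L z)) - mean P2 G.
  by rewrite -meanB//; apply: eq_mean => z; rewrite /G; ring.
rewrite subr_ge0; have cv := @cvg_mean_series_exp _ _ _ [the probability _ _ of P2] _ _ bG bL.
rewrite -(cvg_lim _ cv)//.
apply: limr_ge; first by apply/cvg_ex; eexists; exact: cv.
(* The partial sum of order [n >= 1] contains the term [L ^+ 0], which is the one
   that the subtraction of [1] removes. *)
exists 1%N => // n /= n1.
pose H i z := (i`!%:R)^-1 * ((F z * L z ^+ i) * duplicated_prod l z).
have gH i : ginibre_cone (fun z => F z * L z ^+ i) by exact: ginibre_mulL.
have bH i : bmeas (H i) by apply: bmeasZ; apply: bprod; case: (gH i).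
rewrite (_ : mean P2 (fun z => G z * _) = \sum_(i <- index_iota 0 n) mean P2 (H i)).
  rewrite -(prednK n1) big_nat_recl//.
  rewrite (_ : mean P2 (H 0) = mean P2 G).
    rewrite lerDl sumr_ge0// => i _; rewrite /H meanZ.
      by rewrite mulr_ge0// ?invr_ge0//; case: (gH i.+1).
    by apply: bprod; case: (gH i.+1).
  by apply: eq_mean => z; rewrite /H /G fact0 invr1 mul1r expr0 mulr1.
rewrite -mean_sum//; apply: eq_mean => z.
rewrite /series/= mulr_sumr; apply: eq_bigr => i _.
by rewrite /H /G /exp_coeff/=; ring.
Qed.

Lemma ginibre_expR F : ginibre_cone F ->
  ginibre_cone (fun z => F z * expR (L z)).
Proof.
move=> gF; rewrite (_ : (fun z => _) = (fun z => F z * (expR (L z) - 1) + F z)).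
  by apply: ginibreD => //; exact: ginibre_expR_sub1.
by apply/funext => z; rewrite mulrBr mulr1 subrK.
Qed.

End Exponential.

End Ginibre.

(** * Correlations along a ray of couplings *)

Lemma eq_correlation (R : realType) (V : finType) (E : {set {set V}})
    (J1 J2 : {set V} -> R) a : {in E, J1 =1 J2} ->
  correlation E J1 a = correlation E J2 a.
Proof.
move=> eJ; have eb : boltzmann E J1 = boltzmann E J2.
  apply/funext => theta; congr expR.
  by apply: eq_bigr => e eE; rewrite eJ.
by rewrite /correlation /gibbs_expectation /gibbs_density /partition_function eb.
Qed.

Section Correlation.
Context (R : realType) (V : finType) (E : {set {set V}}).
Hypothesis simpleE : simple_graph E.
Local Notation config := (config R V).
Local Notation P := (config_prob R V).
Local Notation P2 := (config_prob R V \x config_prob R V)%E.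
Implicit Types (J w : {set V} -> R) (a : V -> int) (theta : config).

(** The integer vector [m] with [m . theta = theta_u - theta_v] for [e = {u, v}]. It
    turns an edge term into the cosine of a phase. *)
Definition edge_vector (e : {set V}) : V -> int :=
  if enum e is [:: u; v] then fun x => (x == u)%:Z - (x == v)%:Z else fun=> 0.

Lemma edge_cosE theta e : e \in E ->
  edge_cos theta e = cos (phase (edge_vector e) theta).
Proof.
have one u : phase (fun x => (x == u)%:Z) theta = angle theta u.
  rewrite /phase (bigD1 u)//= eqxx mul1r big1 ?addr0// => v /negPf ->.
  by rewrite mul0r.
move=> /simpleE; rewrite /edge_cos /edge_vector cardE.
case: (enum e) => [//|u [//|v [|//]]] _.
by rewrite phaseB !one.
Qed.

Definition energy J theta : R := \sum_(e in E) J e * edge_cos theta e.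

Lemma energyE J theta :
  energy J theta = \sum_(e <- enum E) J e * cos (phase (edge_vector e) theta).
Proof. by rewrite big_enum; apply: eq_bigr => e eE; rewrite edge_cosE. Qed.

Lemma energyD J w theta t :
  energy (fun e => J e + t * w e) theta = energy J theta + t * energy w theta.
Proof.
rewrite /energy mulr_sumr -big_split; apply: eq_bigr => e _ /=.
by rewrite mulrDl mulrA.
Qed.

Lemma bmeas_energy J : bmeas (energy J).
Proof.
rewrite (funext (energyE J)); apply: bmeas_sum => e.
by apply: bmeasZ; exact: bmeas_cos_phase.
Qed.

Lemma energy_le w theta : (forall e, 0 <= w e) ->
  energy w theta <= \sum_(e in E) w e.
Proof.
move=> w0; apply: ler_sum => e eE.
by rewrite edge_cosE// ler_piMr// cos_le1.
Qed.

Lemma boltzmannE J theta : boltzmann E J theta = expR (energy J theta).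
Proof. by []. Qed.

Lemma bmeas_boltzmann J : bmeas (boltzmann E J).
Proof. by apply: bmeas_expR; exact: bmeas_energy. Qed.

Lemma boltzmannD J w theta t :
  boltzmann E (fun e => J e + t * w e) theta = boltzmann E J theta * expR (t * energy w theta).
Proof. by rewrite !boltzmannE energyD expRD. Qed.

Lemma partition_functionE J : partition_function E J = mean P (boltzmann E J).
Proof. by []. Qed.

Lemma partition_function_gt0 J : 0 < partition_function E J.
Proof. by apply: mean_expR_gt0; exact: bmeas_energy. Qed.

Lemma correlationE J a :
  correlation E J a =
  mean P (fun x => cos (phase a x) * boltzmann E J x) / partition_function E J.
Proof.
rewrite /correlation /gibbs_expectation /gibbs_density -/(partition_function E J).
rewrite [RHS]mulrC -meanZ.
  by apply: eq_mean => x; rewrite mulrA mulrC.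
by apply: bmeasM; [exact: bmeas_cos_phase | exact: bmeas_boltzmann].
Qed.

(** The Gibbs covariance of [cos (a . theta)] and [energy w], multiplied by the
    square of the partition function to clear denominators. *)
Definition covariance J w a : R :=
  mean P (fun x => cos (phase a x) * energy w x * boltzmann E J x) *
  partition_function E J -
  mean P (fun x => cos (phase a x) * boltzmann E J x) *
  mean P (fun x => energy w x * boltzmann E J x).

Definition pair_energy J (z : config * config) : R :=
  \sum_(e <- enum E) J e * duplicated (false, edge_vector e) z.

Lemma expR_pair_energy J z :
  expR (pair_energy J z) = boltzmann E J z.1 * boltzmann E J z.2.
Proof.
rewrite !boltzmannE -expRD !energyE -big_split; congr expR.
by apply: eq_bigr => e _; rewrite /duplicated /= mul1r mulrDr.
Qed.

Let pair_term J a e : config * config -> R := fun z =>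
  duplicated_prod [:: (true, a); (true, edge_vector e)] z *
  expR (pair_energy J z).

(** Twice a covariance is the mean over two independent copies of the product of the
    differences between the copies; [energy w] being a sum over edges, so is the
    result. *)
Lemma covarianceE J w a :
  2 * covariance J w a = \sum_(e <- enum E) w e * mean P2 (pair_term J a e).
Proof.
have bp e : bmeas (pair_term J a e).
  apply: bmeasM; first exact: bmeas_duplicated_prod.
  apply: bmeas_expR; apply: bmeas_sum => i; apply: bmeasZ.
  exact: bmeas_duplicated.
under eq_bigr => e _ do rewrite -(@meanZ _ _ _ [the probability _ _ of P2])//.
rewrite -(@mean_sum _ _ _ [the probability _ _ of P2]); last first.
  by move=> e; exact: bmeasZ.
pose A (x : config) : R := cos (phase a x).
have bA : bmeas A by exact: bmeas_cos_phase.
have bW := bmeas_energy w; have bE := bmeas_boltzmann J.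
pose f x := A x * energy w x * boltzmann E J x.
pose g x := A x * boltzmann E J x.
pose h x := energy w x * boltzmann E J x.
have bg : bmeas g by exact: bmeasM.
have bh : bmeas h by exact: bmeasM.
have bf : bmeas f by apply: bmeasM => //; exact: bmeasM.
transitivity (mean P2 (fun z => f z.1 * boltzmann E J z.2 + boltzmann E J z.1 * f z.2 -
    (g z.1 * h z.2 + h z.1 * g z.2))); last first.
  apply: eq_mean => z; rewrite [LHS](_ : _ =
    (A z.1 - A z.2) * (energy w z.1 - energy w z.2) *
    (boltzmann E J z.1 * boltzmann E J z.2)); last by rewrite /f /g /h; ring.
  rewrite -expR_pair_energy !energyE -sumrB mulr_sumr mulr_suml.
  apply: eq_bigr => e _.
  rewrite /pair_term /duplicated_prod !big_cons big_nil mulr1 /duplicated/=.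
  by rewrite expr1 !mulN1r /A; ring.
rewrite (@meanB _ _ _ [the probability _ _ of P2]); last 2 first.
- by apply: bmeasD; [exact: (bmeas_tensor bf bE) | exact: (bmeas_tensor bE bf)].
- by apply: bmeasD; [exact: (bmeas_tensor bg bh) | exact: (bmeas_tensor bh bg)].
rewrite !(@meanD _ _ _ [the probability _ _ of P2]); last 4 first.
- exact: (bmeas_tensor bg bh).
- exact: (bmeas_tensor bh bg).
- exact: (bmeas_tensor bf bE).
- exact: (bmeas_tensor bE bf).
rewrite (mean_prod P P bf bE) (mean_prod P P bE bf).
rewrite (mean_prod P P bg bh) (mean_prod P P bh bg).
by rewrite /covariance -partition_functionE -/f -/g -/h; ring.
Qed.

Lemma covariance_ge0 J w a : (forall e, 0 <= J e) -> (forall e, 0 <= w e) ->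
  0 <= covariance J w a.
Proof.
move=> J0 w0; rewrite -(pmulr_rge0 _ (ltr0n _ 2)) covarianceE.
apply: sumr_ge0 => e _; rewrite mulr_ge0//; apply: ginibre_mean_ge0.
by apply: ginibre_expR => //; exact: ginibre_prod.
Qed.

(** Increasing the couplings multiplies each two-copy integrand by the exponential
    of a pair energy, so the increment is governed by [ginibre_expR_sub1]. *)
Lemma covariance_le J w a t : (forall e, 0 <= J e) -> (forall e, 0 <= w e) ->
  0 <= t -> covariance J w a <= covariance (fun e => J e + t * w e) w a.
Proof.
move=> J0 w0 t0; rewrite -(ler_pM2l (ltr0n _ 2)) !covarianceE.
apply: ler_sum => e _; apply: ler_wpM2l => //.
pose D z := duplicated_prod [:: (true, a); (true, edge_vector e)] z *
  expR (pair_energy J z).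
have gD : ginibre_cone D by apply: ginibre_expR => //; exact: ginibre_prod.
have gT : ginibre_cone (fun z =>
    D z * (expR (pair_energy (fun e => t * w e) z) - 1)).
  by apply: ginibre_expR_sub1 => // i; exact: mulr_ge0.
rewrite [X in _ <= X](_ : _ = mean P2 D +
    mean P2 (fun z => D z * (expR (pair_energy (fun e => t * w e) z) - 1))).
  by rewrite lerDl; exact: ginibre_mean_ge0.
rewrite -(@meanD _ _ _ [the probability _ _ of P2]); last 2 first.
- exact: gD.1.
- exact: gT.1.
apply: eq_mean => z; rewrite mulrBr mulr1 addrC subrK -mulrA -expRD.
congr (_ * expR _); rewrite /pair_energy -big_split.
by apply: eq_bigr => i _; rewrite mulrDl.
Qed.

(** The energy in the direction [w] never exceeds the total weight of [w]. *)
Lemma partition_function_le J w k t : (forall e, 0 <= w e) ->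
    \sum_(e in E) w e <= k -> 0 <= t ->
  partition_function E (fun e => J e + t * w e) <= expR (k * t) * partition_function E J.
Proof.
move=> w0 wk t0; rewrite !partition_functionE -meanZ; last exact: bmeas_boltzmann.
apply: ler_mean; first exact: bmeas_boltzmann.
  by apply: bmeasZ; exact: bmeas_boltzmann.
move=> x; rewrite boltzmannD mulrC ler_wpM2r ?expR_ge0// ler_expR mulrC.
by rewrite ler_wpM2r// (le_trans _ wk)// energy_le.
Qed.

Lemma is_derive_correlation J w a (t : R) :
  is_derive t 1 (fun t => correlation E (fun e => J e + t * w e) a)
    (covariance (fun e => J e + t * w e) w a /
     partition_function E (fun e => J e + t * w e) ^+ 2).
Proof.
have bA : bmeas (fun x : config => cos (phase a x)) by exact: bmeas_cos_phase.
have bW := bmeas_energy w; have bJ := bmeas_boltzmann J.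
pose f (s : R) := mean P (fun x => (cos (phase a x) * boltzmann E J x) *
  expR (s * energy w x)).
pose z (s : R) := mean P (fun x => boltzmann E J x * expR (s * energy w x)).
have df := is_derive_mean_expR P t (bmeasM bA bJ) bW.
have dz := is_derive_mean_expR P t bJ bW.
have fE s : mean P (fun x => cos (phase a x) * boltzmann E (fun e => J e + s * w e) x)
    = f s.
  by apply: eq_mean => x; rewrite boltzmannD mulrA.
have zE s : partition_function E (fun e => J e + s * w e) = z s.
  by apply: eq_mean => x; rewrite boltzmannD.
have z0 : z t != 0 by rewrite -zE gt_eqF// partition_function_gt0.
rewrite (_ : (fun s => correlation _ _ _) = (fun s => f s * (z s)^-1)); last first.
  by apply/funext => s; rewrite correlationE fE zE.
have dzV := is_deriveV z0 dz.
apply: is_derive_eq.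
rewrite /covariance zE fE /GRing.scale/= -/(f t) -/(z t).
rewrite (_ : mean P (fun x => cos (phase a x) * energy w x * _) =
  mean P (fun x => cos (phase a x) * boltzmann E J x * energy w x *
    expR (t * energy w x))); last first.
  by apply: eq_mean => x; rewrite boltzmannD; ring.
rewrite (_ : mean P (fun x => energy w x * _) =
  mean P (fun x => boltzmann E J x * energy w x * expR (t * energy w x))); last first.
  by apply: eq_mean => x; rewrite boltzmannD; ring.
by field.
Qed.

End Correlation.

(** * Convexity in the time [H_ k] *)

Section TimeChangeConvexity.
Context (R : realType).
Implicit Types (k r t s b : R).

Lemma B_E k r t : B_ k r t = - (2 * k)^-1 * ln (1 - r * H_ k t).
Proof. by []. Qed.

Lemma H_0 k : H_ k 0 = 0.
Proof. by rewrite /H_ mulr0 oppr0 expR0 subrr. Qed.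

Lemma ler_H_ k s t : 0 < k -> (H_ k s <= H_ k t) = (s <= t).
Proof.
by move=> k0; rewrite /H_ lerD2l lerN2 ler_expR lerN2 ler_pM2l// mulr_gt0.
Qed.

Lemma B_ge0 k r t : 0 < k -> 0 <= t -> 0 <= r <= 1 -> 0 <= B_ k r t.
Proof.
move=> k0 t0 r01; have /andP[r0 r1] := r01.
by rewrite -(ler_H_ _ _ k0) H_0 H_B_// mulr_ge0// -(H_0 k) ler_H_.
Qed.

Lemma B_le k r t : 0 < k -> 0 <= t -> 0 <= r <= 1 -> B_ k r t <= t.
Proof.
move=> k0 t0 r01; have /andP[r0 r1] := r01.
by rewrite -(ler_H_ _ _ k0) H_B_// ler_piMl// -(H_0 k) ler_H_.
Qed.

Lemma B_B k r t : 0 < k -> 0 <= t -> 0 <= r <= 1 ->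
  B_ k r (B_ k r t) = B_ k (r ^+ 2) t.
Proof. by move=> k0 t0 r01; rewrite B_E H_B_// mulrA -expr2. Qed.

Lemma is_derive_H_ k t : is_derive t 1 (H_ k) (2 * k * expR (- (2 * k * t))).
Proof.
apply: is_derive_eq.
rewrite /GRing.scale/= !(mulr1, mulr0, add0r, addr0).
by rewrite mul1r mulrN opprK mulrC.
Qed.

(** The function [g t = N t / Z t ^+ 2 * expR (2 * k * t)] is [2 * k] times the
    derivative of [C] with respect to [H_ k]. It is nondecreasing, so [C] is a convex
    function of [H_ k] and lies above its tangent at [B_ k r t]. *)
Lemma convex_in_H_ (C N Z : R -> R) k r t : 0 < k -> 0 <= t -> 0 <= r <= 1 ->
  (forall s, is_derive s 1 C (N s / Z s ^+ 2)) ->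
  (forall s, 0 < Z s) -> (forall s, 0 <= s -> 0 <= N s) ->
  (forall s u, 0 <= s -> s <= u -> N s <= N u) ->
  (forall s u, 0 <= s -> s <= u -> Z u <= expR (k * (u - s)) * Z s) ->
  C (B_ k r t) <= (1 - r) * C 0 + r * C t.
Proof.
move=> k0 t0 r01 dC Z0 N0 Nle Zle; have /andP[r0 r1] := r01.
set b := B_ k r t.
have b0 : 0 <= b by exact: B_ge0.
have bt : b <= t by exact: B_le.
pose g s := N s / Z s ^+ 2 * expR (2 * k * s).
have gle s u : 0 <= s -> s <= u -> g s <= g u.
  move=> s0 su; rewrite /g mulrAC [leRHS]mulrAC.
  rewrite ler_pdivrMr ?exprn_gt0// [leRHS]mulrAC ler_pdivlMr ?exprn_gt0//.
  have eE : expR (2 * k * u) = expR (2 * k * s) * expR (k * (u - s)) ^+ 2.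
    rewrite -expRM_natl -expRD; congr expR.
    by ring.
  have ZZ : Z u ^+ 2 <= (expR (k * (u - s)) * Z s) ^+ 2.
    by rewrite lerXn2r ?nnegrE ?Zle// ?mulr_ge0 ?expR_ge0// ltW.
  have -> : N u * expR (2 * k * u) * Z s ^+ 2 =
      N u * (expR (2 * k * s) * (expR (k * (u - s)) * Z s) ^+ 2).
    by rewrite eE; ring.
  rewrite -[leLHS]mulrA; apply: ler_pM; [exact: N0| |exact: Nle|].
    by rewrite mulr_ge0 ?expR_ge0 ?exprn_ge0// ltW.
  by rewrite ler_pM2l ?expR_gt0.
(* The tangent at [b], as a function of [H_ k], has slope [g b / (2 * k)]. *)
pose psi s := C s - g b / (2 * k) * H_ k s.
have dpsi s : is_derive s 1 psi (expR (- (2 * k * s)) * (g s - g b)).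
  have dH := is_derive_H_ k s; have dCs := dC s.
  apply: is_derive_eq.
  have gE : expR (- (2 * k * s)) * g s = N s / Z s ^+ 2.
    by rewrite /g mulrCA -expRD addNr expR0 mulr1.
  rewrite /GRing.scale/= mulrBr gE; congr (_ - _).
  by field; rewrite gt_eqF.
have ps s : derivable psi s 1 by exact: (@ex_derive _ _ _ _ _ _ _ (dpsi s)).
have cpsi (x y : R) : {within `[x, y], continuous psi}%classic.
  apply: continuous_subspaceT => s.
  by apply: differentiable_continuous; apply/derivable1_diffP.
have low : psi b <= psi 0.
  apply: (@ler0_derive1_nincr _ psi 0 b) => // s; rewrite in_itv/= => /andP[s0 sb].
  rewrite derive1E derive_val mulr_ge0_le0 ?expR_ge0// subr_le0.
  by apply: gle; exact: ltW.
have high : psi b <= psi t.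
  apply: (@ger0_derive1_ndecr _ psi b t) => // s; rewrite in_itv/= => /andP[bs st].
  rewrite derive1E derive_val mulr_ge0 ?expR_ge0// subr_ge0.
  by apply: gle => //; exact: ltW.
have : psi b <= (1 - r) * psi 0 + r * psi t.
  rewrite -[leLHS]mul1r -[in leLHS](subrK r 1) mulrDl lerD// ler_wpM2l//.
  by rewrite subr_ge0.
rewrite /psi H_0 [H_ k b]H_B_// mulr0 subr0.
by rewrite [r * (C t - _)]mulrBr addrA [r * (_ * H_ k t)]mulrCA lerD2r.
Qed.

End TimeChangeConvexity.

(** * Thinning *)

Section Thinning.
Context (R : realType) (V : finType) (E : {set {set V}}).
Hypothesis simpleE : simple_graph E.

(** In the applications [w] is the indicator of the edges opened by one disorder
    variable, and [k] bounds their number. *)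
Lemma correlation_ray_le (J w : {set V} -> R) a (k r t : R) :
  (forall e, 0 <= J e) -> (forall e, 0 <= w e) -> \sum_(e in E) w e <= k ->
  0 < k -> 0 <= t -> 0 <= r <= 1 ->
  correlation E (fun e => J e + B_ k r t * w e) a <=
  (1 - r) * correlation E J a +
  r * correlation E (fun e => J e + t * w e) a.
Proof.
move=> J0 w0 wk k0 t0 r01.
have -> : correlation E J a = correlation E (fun e => J e + 0 * w e) a.
  by apply: eq_correlation => e _; rewrite mul0r addr0.
pose Jt s e := J e + s * w e.
have Jt0 s : 0 <= s -> forall e, 0 <= Jt s e.
  by move=> s0 e; rewrite addr_ge0// mulr_ge0.
have JtD s u : Jt u = (fun e => Jt s e + (u - s) * w e).
  by apply/funext => e; rewrite /Jt; ring.
apply: (@convex_in_H_ _ (fun s => correlation E (Jt s) a)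
  (fun s => covariance E (Jt s) w a) (fun s => partition_function E (Jt s))) => //.
- by move=> s; exact: is_derive_correlation.
- by move=> s; exact: partition_function_gt0.
- by move=> s s0; apply: covariance_ge0 => //; exact: Jt0.
- move=> s u s0 su; rewrite (JtD s u).
  by apply: covariance_le => //; [exact: Jt0 | rewrite subr_ge0].
- move=> s u s0 su; rewrite (JtD s u).
  by apply: partition_function_le => //; rewrite subr_ge0.
Qed.

End Thinning.

(** * Replacing the disorder variables one at a time *)

Section BernoulliReplacement.
Context (R : realType) (I : finType) (S : {set I}).
Implicit Types (rho : I -> R) (T w : {set I}).

Definition product_expectation rho (X : {set I} -> R) : R :=
  \sum_(w in powerset S) (\prod_(i in S) bernoulli_pmf (rho i) (i \in w)) * X w.

Lemma eq_product_expectation rho1 rho2 (X1 X2 : {set I} -> R) :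
  {in S, rho1 =1 rho2} -> X1 =1 X2 ->
  product_expectation rho1 X1 = product_expectation rho2 X2.
Proof.
move=> erho eX; apply: eq_bigr => w _; rewrite eX; congr (_ * _).
by apply: eq_bigr => i iS; rewrite erho.
Qed.

(** By independence, the variable [i] can be averaged first, the others being
    frozen. *)
Lemma product_expectation_split rho (X : {set I} -> R) i : i \in S ->
  product_expectation rho X =
  \sum_(w in powerset (S :\ i))
    (\prod_(j in S :\ i) bernoulli_pmf (rho j) (j \in w)) *
    (rho i * X (i |: w) + (1 - rho i) * X w).
Proof.
move=> iS; rewrite /product_expectation (bigID (fun w : {set I} => i \in w))/=.
under [RHS]eq_bigr do rewrite mulrDr.
rewrite big_split /=; congr (_ + _).
- rewrite (reindex_onto (fun w => i |: w) (fun w => w :\ i)); last first.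
    by move=> w /andP[_ iw]; rewrite setD1K.
  apply: eq_big => [w|w /andP[/andP[_ _] /eqP wK]].
    rewrite !powersetE subUset sub1set iS/= setU11 andbT subsetD1.
    apply: andb_id2l => _; apply/eqP/idP => [<-|]; first by rewrite setD11.
    exact: setU1K.
  rewrite (big_setD1 i iS)/= setU11 /= [rho i * _]mulrC -!mulrA mulrCA.
  congr (_ * _); last by rewrite mulrC.
  by apply: eq_bigr => j /setD1P[ji _]; rewrite !inE (negPf ji).
- apply: eq_big => [w|w /andP[_ iw]]; first by rewrite !powersetE subsetD1.
  rewrite (big_setD1 i iS)/= (negPf iw) /=.
  by rewrite mulrCA mulrA.
Qed.

(** Each index moved into [T] has its density raised from [q * r] to [q]; the
    hypothesis on [X] says that the accompanying change of the couplings
    compensates this, the other variables [w] being frozen. *)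
Lemma product_expectation_replace (X : {set I} -> {set I} -> R) (q r : R)
    (T0 T1 : {set I}) : 0 <= q <= 1 -> 0 <= r <= 1 -> T0 \subset T1 ->
  T1 \subset S ->
  (forall T i w, T0 \subset T -> T \subset T1 -> i \in T1 -> i \notin T ->
    i \notin w -> X (i |: T) w = X T w /\
    X (i |: T) (i |: w) <= (1 - r) * X T w + r * X T (i |: w)) ->
  product_expectation (fun i => if i \in T1 then q else q * r) (X T1) <=
  product_expectation (fun i => if i \in T0 then q else q * r) (X T0).
Proof.
move=> /andP[q0 q1] /andP[r0 r1] T01 T1S HX.
pose Phi T := product_expectation (fun i => if i \in T then q else q * r) (X T).
have qr01 : 0 <= q * r <= 1 by rewrite mulr_ge0// mulr_ile1.
have step T i : T0 \subset T -> T \subset T1 -> i \in T1 -> i \notin T ->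
    Phi (i |: T) <= Phi T.
  move=> T0T TT1 iT1 iT; have iS : i \in S by exact: (subsetP T1S).
  rewrite /Phi !(product_expectation_split _ _ iS); apply: ler_sum => w.
  rewrite powersetE subsetD1 => /andP[_ iw].
  rewrite setU11 (negPf iT).
  have -> : \prod_(j in S :\ i) bernoulli_pmf (if j \in i |: T then q else q * r)
        (j \in w) =
      \prod_(j in S :\ i) bernoulli_pmf (if j \in T then q else q * r) (j \in w).
    by apply: eq_bigr => j /setD1P[ji _]; rewrite !inE (negPf ji).
  rewrite ler_wpM2l//.
    by rewrite prodr_ge0// => j _; apply: bernoulli_pmf_ge0; case: ifP => // _;
      rewrite q0.
  have [-> H] := HX T i w T0T TT1 iT1 iT iw.
  have := ler_wpM2l q0 H.
  set x := X T w; set y := X T (i |: w); set z := X _ _ => Hq.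
  have -> : q * r * y + (1 - q * r) * x = q * ((1 - r) * x + r * y) + (1 - q) * x.
    by ring.
  by rewrite lerD2r.
rewrite -/(Phi T1) -/(Phi T0).
move nE : #|T1 :\: T0| => n; elim: n T0 T01 HX step nE => [|n IH] T0' T01 HX step nE.
  have -> // : T1 = T0'.
  by apply/eqP; rewrite eqEsubset T01 andbT -setD_eq0 -cards_eq0 nE.
have /card_gt0P[i] : (0 < #|T1 :\: T0'|)%N by rewrite nE.
rewrite inE => /andP[iT0 iT1].
apply: le_trans (step T0' i _ _ iT1 iT0) => //.
apply: IH.
- by rewrite subUset sub1set iT1.
- by move=> T j w /subUsetP[_ T0T]; exact: HX.
- by move=> T j /subUsetP[_ T0T]; exact: step.
- have := cardsD1 i (T1 :\: T0').
  rewrite nE !inE iT0 iT1 add1n => -[->].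
  by apply: eq_card => j; rewrite !inE negb_or andbA.
Qed.

End BernoulliReplacement.

Section BondModel.
Context (R : realType) (V : finType) (E : {set {set V}}).
Hypothesis simpleE : simple_graph E.

(** A bond variable opens a single edge, whence [k = 1]. *)
Lemma F_bond_thinning (q r beta : R) a : 0 <= q <= 1 -> 0 <= r <= 1 -> 0 <= beta ->
  F_bond E q (B_ 1 r beta) a <= F_bond E (q * r) beta a.
Proof.
move=> q01 r01 beta0.
pose b := B_ 1 r beta; have b0 : 0 <= b by exact: B_ge0.
pose J (T w : {set {set V}}) (e : {set V}) : R :=
  (if e \in T then b else beta) * (e \in w)%:R.
have J0 T w e : 0 <= J T w e by rewrite mulr_ge0//; case: ifP.
pose X T w := correlation E (J T w) a.
have := @product_expectation_replace R _ E X q r set0 E q01 r01 (sub0set _)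
  (subxx _).
rewrite (_ : product_expectation _ _ (X E) = F_bond E q b a); last first.
  apply: eq_product_expectation => [e -> //|w].
  by apply: eq_correlation => e eE; rewrite /J eE.
rewrite (_ : product_expectation _ _ (X set0) = F_bond E (q * r) beta a); last first.
  apply: eq_product_expectation => [e _|w]; first by rewrite inE.
  by apply: eq_correlation => e eE; rewrite /J inE.
apply => T i w _ _ iE iT iw; split.
  apply: eq_correlation => e _; rewrite /J !inE.
  by have [->|] := eqVneq e i; rewrite ?(negPf iw) ?mulr0.
pose W (e : {set V}) : R := (e == i)%:R.
have JE : J (i |: T) (i |: w) = (fun e => J T w e + b * W e).
  apply/funext => e; rewrite /J /W !inE.
  by have [->|_] := eqVneq e i; rewrite ?(negPf iw) ?mulr0 ?add0r ?addr0.
have JE' : J T (i |: w) = (fun e => J T w e + beta * W e).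
  apply/funext => e; rewrite /J /W !inE.
  have [->|_] := eqVneq e i; last by rewrite mulr0 addr0.
  by rewrite (negPf iw) (negPf iT) mulr0 add0r.
rewrite /X JE JE'; apply: correlation_ray_le => //.
by rewrite (bigD1 i iE)/= /W eqxx big1 ?addr0// => e /andP[_ /negPf ->].
Qed.

End BondModel.

Section SiteModel.
Context (R : realType) (V : finType) (E : {set {set V}}) (Delta : nat).
Hypothesis simpleE : simple_graph E.
Hypothesis Delta1 : (1 <= Delta)%N.
Hypothesis degE : (max_degree E <= Delta)%N.
Variables (r beta : R).
Hypothesis r01 : 0 <= r <= 1.
Hypothesis beta0 : 0 <= beta.

Let b n : R := iter n (B_ Delta%:R r) beta.

Let Delta_gt0 : 0 < Delta%:R :> R.
Proof. by rewrite ltr0n. Qed.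

Let b0 n : 0 <= b n.
Proof. by elim: n => [//|n IH]; exact: B_ge0. Qed.

(** The vertices of [T] have been treated: an edge feels one change of time
    per treated endpoint. *)
Let J (T eta : {set V}) (e : {set V}) : R := b #|T :&: e| * (e \subset eta)%:R.

Let X a T eta := correlation E (J T eta) a.

(** The hypothesis on [j] says that the edges at [i] all carry the same time; this
    is what makes the change of [i] a motion along one ray of couplings. *)
Let site_step a (T : {set V}) i (eta : {set V}) j : i \notin T -> i \notin eta ->
  (forall e, e \in E -> i \in e -> #|T :&: e| = j) ->
  X a (i |: T) eta = X a T eta /\
  X a (i |: T) (i |: eta) <= (1 - r) * X a T eta + r * X a T (i |: eta).
Proof.
move=> iT ieta Tj.
have cardU (e : {set V}) : i \notin e -> (i |: T) :&: e = T :&: e.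
  move=> ie; rewrite setIUl (_ : [set i] :&: e = set0) ?set0U//.
  by apply/eqP; rewrite setI_eq0 disjoints1.
have vacant (e : {set V}) : i \in e -> (e \subset eta) = false.
  by move=> ie; apply/negP => /subsetP/(_ _ ie); rewrite (negPf ieta).
have subU (e : {set V}) : i \notin e -> (e \subset i |: eta) = (e \subset eta).
  by move=> ie; rewrite -subDset (setDidPl _)// disjoint_sym disjoints1.
split.
  apply: eq_correlation => e _; rewrite /J.
  have [ie|ie] := boolP (i \in e); first by rewrite vacant// !mulr0.
  by rewrite cardU.
pose W (e : {set V}) : R := ((i \in e) && (e \subset i |: eta))%:R.
have JE : {in E, J (i |: T) (i |: eta) =1 fun e => J T eta e + b j.+1 * W e}.
  move=> e eE; rewrite /J /W; have [ie|ie] := boolP (i \in e) => /=.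
    rewrite vacant// mulr0 add0r (_ : (i |: T) :&: e = i |: (T :&: e)).
      by rewrite cardsU1 inE (negPf iT)/= Tj.
    by rewrite setIUl (setIidPl _)// sub1set.
  by rewrite cardU// subU// mulr0 addr0.
have JE' : {in E, J T (i |: eta) =1 fun e => J T eta e + b j * W e}.
  move=> e eE; rewrite /J /W; have [ie|ie] := boolP (i \in e) => /=.
    by rewrite vacant// mulr0 add0r Tj.
  by rewrite subU// mulr0 addr0.
rewrite /X (eq_correlation a JE) (eq_correlation a JE').
apply: correlation_ray_le => //.
- by move=> e; rewrite mulr_ge0.
- apply: (@le_trans _ _ (degree E i)%:R); last first.
    by rewrite ler_nat (leq_trans _ degE)// /max_degree leq_bigmax.
  rewrite /degree -sum1_card natr_sum big_mkcond [leRHS]big_mkcond/=.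
  apply: ler_sum => e _; rewrite inE /W; case: (e \in E) => //=.
  by case: (i \in e); rewrite // lern1 leq_b1.
Qed.

(** The class [A] of the bipartition is treated first: an edge at a vertex of [A]
    then has no treated endpoint, and an edge at a vertex outside [A] has exactly
    one, its endpoint in [A]. *)
Lemma F_site_thinning (q : R) a : bipartite E -> 0 <= q <= 1 ->
  F_site E q (B_ Delta%:R (r ^+ 2) beta) a <= F_site E (q * r) beta a.
Proof.
move=> [A bipA] q01.
have Ai i (e : {set V}) : e \in E -> i \in e ->
    exists2 u, e = [set i; u] & (i \in A) != (u \in A).
  move=> eE; have /eqP/cards2P[x [y [_ eE2]]] := simpleE eE.
  move: (eE); rewrite eE2 => xyE; rewrite !inE => /orP[]/eqP ->.
    by exists y; [|exact: bipA].
  by exists x; [rewrite setUC | apply: bipA; rewrite setUC].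
have siteJ (eta e : {set V}) : e \in E -> \prod_(v in e) (v \in eta)%:R = (e \subset eta)%:R :> R.
  move=> eE; have [/subsetP sub|] := boolP (e \subset eta).
    by rewrite big1// => v /sub ->.
  by move=> /subsetPn[v ve veta]; rewrite (bigD1 v ve)/= (negPf veta) mul0r.
have stepA := @product_expectation_replace R _ setT (X a) q r set0 A q01 r01
  (sub0set _) (subsetT _).
have stepB := @product_expectation_replace R _ setT (X a) q r A setT q01 r01
  (subsetT _) (subxx _).
move: stepA; rewrite (_ : product_expectation _ _ (X a set0) = F_site E (q * r) beta a);
    last first.
  apply: eq_product_expectation => [v _|eta]; first by rewrite inE.
  by apply: eq_correlation => e eE; rewrite /J set0I cards0 /site_coupling siteJ.
move: stepB; rewrite (_ : product_expectation _ _ (X a setT) =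
    F_site E q (B_ Delta%:R (r ^+ 2) beta) a); last first.
  apply: eq_product_expectation => [v _|eta]; first by rewrite inE.
  apply: eq_correlation => e eE.
  by rewrite /J setTI (simpleE eE) /site_coupling siteJ// /b /= B_B.
move=> stepB stepA; apply: le_trans (stepB _) (stepA _).
- move=> T i w AT _ _ iT iw; apply: (@site_step _ _ _ _ 1) => // e eE ie.
  have [u -> iAu] := Ai i e eE ie.
  have iA : i \notin A by apply: contra iT; exact: (subsetP AT).
  have uT : u \in T.
    by apply: (subsetP AT); move: iAu; rewrite (negPf iA); case: (u \in A).
  rewrite setIUr (_ : T :&: [set i] = set0) ?set0U; last first.
    by apply/eqP; rewrite setI_eq0 disjoint_sym disjoints1.
  by rewrite (setIidPr _) ?cards1// sub1set.
- move=> T i w _ TA iA iT iw; apply: (@site_step _ _ _ _ 0) => // e eE ie.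
  have [u -> iAu] := Ai i e eE ie.
  move: iAu; rewrite iA => uA.
  rewrite setIUr (_ : T :&: [set i] = set0) ?set0U; last first.
    by apply/eqP; rewrite setI_eq0 disjoint_sym disjoints1.
  rewrite (_ : T :&: [set u] = set0) ?cards0//.
  apply/eqP; rewrite setI_eq0 disjoint_sym disjoints1.
  by apply: contra uA => /(subsetP TA) ->.
Qed.

End SiteModel.

(** * The comparison theorem *)

Theorem proposition3p1 (R : realType) (p q beta : R)
    (V : finType) (E : {set {set V}}) :
  0 < p -> p <= q -> q <= 1 -> 0 <= beta -> simple_graph E ->
  (forall a : V -> int,
     F_bond E p beta a >= F_bond E q (B_ 1 (p / q) beta) a) /\
  (forall Delta : nat, (1 <= Delta)%N ->
     bipartite E -> (max_degree E <= Delta)%N ->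
     forall a : V -> int,
       F_site E p beta a >= F_site E q (B_ Delta%:R ((p / q) ^+ 2) beta) a).
Proof.
move=> p0 pq q1 beta0 simpleE.
have q0 : 0 < q by exact: lt_le_trans pq.
have q01 : 0 <= q <= 1 by rewrite ltW.
have r01 : 0 <= p / q <= 1 by rewrite ler_pdivrMr// mul1r pq divr_ge0// ltW.
have pE : q * (p / q) = p by rewrite mulrC divfK ?gt_eqF.
split=> [a|Delta Delta1 bipE degE a].
  by rewrite -[in leRHS]pE; exact: F_bond_thinning.
by rewrite -[in leRHS]pE; exact: F_site_thinning.
Qed.
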